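(* Let $0<\alpha\le 1$. A large geodesic segment in $G_\alpha$ is not a length minimizer (i.e. its length is strictly greater than the Riemannian distance between its endpoints).
   Context: For $0<\alpha\le 1$, $G_\alpha$ is the Lie group $\mathbb{R}^3$ with product $(x,y,z)\ast(x',y',z')=(x'e^{z}+x,\;y'e^{-\alpha z}+y,\;z'+z)$, equipped with the left-invariant Riemannian metric $ds^2=e^{-2z}dx^2+e^{2\alpha z}dy^2+dz^2$. The left-invariant orthonormal frame is $X=e^{z}\partial_x,\ Y=e^{-\alpha z}\partial_y,\ Z=\partial_z$; tangent vectors (at any point) are identified with elements $(x,y,z)=xX+yY+zZ$ of the Lie algebra $\mathfrak{g}_\alpha\cong\mathbb{R}^3$. Let $S(G_\alpha)$ be the unit sphere of $\mathfrak{g}_\alpha$. Along a unit-speed geodesic the velocity, expressed in this frame, is an integral curve in $S(G_\alpha)$ of the vector field $\Sigma_\alpha(x,y,z)=(xz,-\alpha yz,\alpha y^2-x^2)$. Period: let $v=(x,y,z)\in S(G_\alpha)$. If $xy\neq 0$ and $v$ is not a zero of $\Sigma_\alpha$, the integral curve of $\Sigma_\alpha$ through $v$ is a closed curve (a loop level set $\lambda$ of $|x|^\alpha y$), and $P(v)=P_\lambda\in(0,\infty)$ is the time needed for the flow of $\Sigma_\alpha$ to go exactly once around it. If $v=(\pm\sqrt{\alpha/(1+\alpha)},\pm\sqrt{1/(1+\alpha)},0)$ (an equilibrium), $P(v)$ denotes the limiting value $\pi\sqrt2/\sqrt\alpha$. If $xy=0$, $P(v)=+\infty$. A geodesic segment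 of length $T>0$ with initial unit tangent vector $v$ is called small if $T<P(v)$, perfect if $T=P(v)$, and large if $T>P(v)$. *)

(* Defs.v *)
From Stdlib Require Import Reals Lra ClassicalEpsilon.
From Coquelicot Require Import Coquelicot.
Open Scope R_scope.

(** Points of [G_alpha], coordinate vectors and elements of the Lie algebra are
    all triples of reals. *)
Definition triple : Type := (R * R * R)%type.

Inductive axis : Set := ax | ay | az.

Definition coord (k : axis) (p : triple) : R :=
  let '(x, y, z) := p in
  match k with ax => x | ay => y | az => z end.

Definition set_coord (k : axis) (r : R) (p : triple) : triple :=
  let '(x, y, z) := p in
  match k with ax => (r, y, z) | ay => (x, r, z) | az => (x, y, r) end.

Definition sum_axes (f : axis -> R) : R := f ax + f ay + f az.

Definition partial (k : axis) (f : triple -> R) (p : triple) : R :=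
  Derive (fun r => f (set_coord k r p)) (coord k p).

Definition velocity (c : R -> triple) (k : axis) (t : R) : R :=
  Derive (fun s => coord k (c s)) t.

(** [G_alpha] as a Riemannian manifold, in the global coordinates [(x, y, z)].
    Only the metric and the left-invariant frame are used; the left translation
    by [(x, y, z)] has differential [diag (e^z, e^(-alpha z), 1)]. *)

Definition metric_diag (alpha : R) (p : triple) (i : axis) : R :=
  match i with
  | ax => exp (- 2 * coord az p)
  | ay => exp (2 * alpha * coord az p)
  | az => 1
  end.

Definition axis_eq_dec (i j : axis) : {i = j} + {i <> j}.
Proof. decide equality. Defined.

Definition metric (alpha : R) (p : triple) (i j : axis) : R :=
  if axis_eq_dec i j then metric_diag alpha p i else 0.

Definition metric_inv (alpha : R) (p : triple) (i j : axis) : R :=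
  if axis_eq_dec i j then / metric_diag alpha p i else 0.

Lemma metric_invE (alpha : R) (p : triple) (i j : axis) :
  sum_axes (fun l => metric_inv alpha p i l * metric alpha p l j)
  = if axis_eq_dec i j then 1 else 0.
Proof.
assert (H : forall k, metric_diag alpha p k <> 0).
{ intros []; simpl; try apply Rgt_not_eq, exp_pos; lra. }
unfold sum_axes, metric_inv, metric.
destruct i, j; simpl;
  repeat match goal with
  | |- context [axis_eq_dec ?a ?b] => destruct (axis_eq_dec a b); try congruence
  end; generalize (H ax) (H ay) (H az); simpl; intros; field; auto.
Qed.

(** [christoffel alpha p k i j] is the symbol of the second kind, with upper
    index [k]. *)
Definition christoffel (alpha : R) (p : triple) (k i j : axis) : R :=
  / 2 * sum_axes (fun l =>
    metric_inv alpha p k l *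
      (partial i (fun q => metric alpha q j l) p
       + partial j (fun q => metric alpha q i l) p
       - partial l (fun q => metric alpha q i j) p)).

Definition is_geodesic (alpha a b : R) (c : R -> triple) : Prop :=
  forall t k, a < t < b ->
    ex_derive (fun s => coord k (c s)) t /\
    is_derive (velocity c k) t
      (- sum_axes (fun i => sum_axes (fun j =>
           christoffel alpha (c t) k i j * velocity c i t * velocity c j t))).

Definition speed (alpha : R) (c : R -> triple) (t : R) : R :=
  sqrt (sum_axes (fun i => sum_axes (fun j =>
    metric alpha (c t) i j * velocity c i t * velocity c j t))).

Definition curve_length (alpha : R) (c : R -> triple) (a b : R) : R :=
  RInt (speed alpha c) a b.

Definition C1_curve (d : R -> triple) : Prop :=
  forall t k, ex_derive (fun s => coord k (d s)) t /\
              continuous (velocity d k) t.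

(** On each closed piece the curve is the restriction of a [C^1] curve defined
    on the whole line; in particular it is continuous on [[a, b]].  At the
    breakpoints [velocity c] is arbitrary, which does not affect the integral
    defining [curve_length]. *)
Definition piecewise_C1 (a b : R) (c : R -> triple) : Prop :=
  exists (n : nat) (s : nat -> R),
    s O = a /\ s n = b /\
    forall m : nat, (m < n)%nat ->
      s m < s (S m) /\
      exists d : R -> triple, C1_curve d /\
        forall t, s m <= t <= s (S m) -> c t = d t.

(** Valued in [Rbar] so that the infimum needs no side condition. *)
Definition riem_dist (alpha : R) (p q : triple) : Rbar :=
  Glb_Rbar (fun L => exists (a b : R) (c : R -> triple),
    a < b /\ piecewise_C1 a b c /\ c a = p /\ c b = q /\
    L = curve_length alpha c a b).

(** Coordinates of [x X + y Y + z Z] at the point [p]. *)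
Definition frame_vector (alpha : R) (p v : triple) : triple :=
  let '(x, y, z) := v in
  (x * exp (coord az p), y * exp (- alpha * coord az p), z).

Definition unit_sphere (v : triple) : Prop :=
  let '(x, y, z) := v in x ^ 2 + y ^ 2 + z ^ 2 = 1.

Definition Sigma (alpha : R) (v : triple) : triple :=
  let '(x, y, z) := v in (x * z, - alpha * y * z, alpha * y ^ 2 - x ^ 2).

Definition integral_curve (alpha : R) (u : R -> triple) : Prop :=
  forall t k, is_derive (fun s => coord k (u s)) t (coord k (Sigma alpha (u t))).

(** The integral curve through [v] being a closed curve, going around it exactly
    once means returning to [v] for the first time.  On the unit sphere the zeros
    of [Sigma] with [x y <> 0] are the four points
    [(+- sqrt (alpha / (1 + alpha)), +- sqrt (1 / (1 + alpha)), 0)]. *)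
Definition period (alpha : R) (v : triple) : Rbar :=
  if Req_EM_T (coord ax v * coord ay v) 0 then p_infty
  else if excluded_middle_informative (Sigma alpha v = (0, 0, 0))
  then Finite (PI * sqrt 2 / sqrt alpha)
  else Glb_Rbar (fun s => 0 < s /\
         exists u : R -> triple, integral_curve alpha u /\ u 0 = v /\ u s = v).

(** A geodesic segment is the restriction to [[0, T]] of a geodesic defined on a
    neighbourhood of it.  Geodesics have constant speed, so the condition at time
    [0] makes it unit-speed, of length [T]. *)
Definition geodesic_segment (alpha T : R) (v : triple) (c : R -> triple) : Prop :=
  0 < T /\ unit_sphere v /\
  (exists eps, 0 < eps /\ is_geodesic alpha (- eps) (T + eps) c) /\
  forall k, velocity c k 0 = coord k (frame_vector alpha (c 0) v).

Definition large_segment (alpha T : R) (v : triple) (c : R -> triple) : Prop :=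
  geodesic_segment alpha T v c /\ Rbar_lt (period alpha v) (Finite T).

(* Main.v *)
Require Import Defs.
From Stdlib Require Import Reals Lra Lia Arith ClassicalEpsilon.
From Coquelicot Require Import Coquelicot.
Open Scope R_scope.

(** If the velocity has period [s < T], then [z] has period [s] along the geodesic,
    since [exp (- z)] times the first component of the velocity is conserved.
    Choose [delta < T - s] with nonzero vertical velocity and put
    [tau = delta + s].  A half turn about a vertical axis is an isometry, and some
    such half turn, followed by time reversal, turns the piece over [[delta, tau]]
    into another path of the same length with the same endpoints.  It meets the
    rest of the geodesic at [tau] with a corner, which a short horizontal chord
    cuts off.

    At an equilibrium the geodesic is a straight line in a plane [z = const], and
    perturbing [z] by [e * sin (2 * PI * t / T)] changes the length at second order
    by a negative multiple of [2 * alpha - (2 * PI / T) ^ 2]. *)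

(** * Geodesic equations and speed in coordinates *)

Lemma triple_eq (p q : triple) : (forall k, coord k p = coord k q) -> p = q.
Proof.
intros H; generalize (H ax) (H ay) (H az).
destruct p as [[? ?] ?], q as [[? ?] ?]; simpl; intros; subst; reflexivity.
Qed.

Lemma partial_metric (alpha : R) (p : triple) (k i j : axis) :
  partial k (fun q => metric alpha q i j) p =
  match i, j, k with
  | ax, ax, az => - 2 * exp (- 2 * coord az p)
  | ay, ay, az => 2 * alpha * exp (2 * alpha * coord az p)
  | _, _, _ => 0
  end.
Proof.
destruct p as [[x y] z].
unfold partial, metric.
destruct i, j;
  match goal with
  | |- context [axis_eq_dec ?a ?b] => destruct (axis_eq_dec a b); try congruence
  end; destruct k; simpl; try apply Derive_const;
  apply is_derive_unique; auto_derive; auto; ring.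
Qed.

Lemma exp_mul_opp (x : R) : exp x * exp (- x) = 1.
Proof. rewrite <- exp_plus, Rplus_opp_r; apply exp_0. Qed.

(** Only the [z]-derivatives of the two horizontal metric coefficients survive. The first two
    equations say that the momenta [exp (- 2 z) x'] and [exp (2 alpha z) y'] are conserved. *)
Lemma geodesic_equation (alpha a b : R) (c : R -> triple) (t : R) :
  is_geodesic alpha a b c -> a < t < b ->
  is_derive (velocity c ax) t (2 * velocity c ax t * velocity c az t) /\
  is_derive (velocity c ay) t
    (- 2 * alpha * velocity c ay t * velocity c az t) /\
  is_derive (velocity c az) t
    (alpha * exp (2 * alpha * coord az (c t)) * velocity c ay t ^ 2
     - exp (- 2 * coord az (c t)) * velocity c ax t ^ 2).
Proof.
intros Hg Ht.
assert (E1 := exp_pos (- 2 * coord az (c t))).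
assert (E2 := exp_pos (2 * alpha * coord az (c t))).
split; [ | split];
  [ generalize (proj2 (Hg t ax Ht)) | generalize (proj2 (Hg t ay Ht))
  | generalize (proj2 (Hg t az Ht))];
  match goal with |- is_derive _ _ ?x -> is_derive _ _ ?y =>
    replace x with y; [auto | ] end;
  unfold sum_axes, christoffel, sum_axes; rewrite !partial_metric;
  unfold metric_inv, metric_diag; simpl; field; lra.
Qed.

Lemma speedE (alpha : R) (c : R -> triple) (t : R) :
  speed alpha c t =
  sqrt (exp (- 2 * coord az (c t)) * velocity c ax t ^ 2
        + exp (2 * alpha * coord az (c t)) * velocity c ay t ^ 2
        + velocity c az t ^ 2).
Proof.
unfold speed, sum_axes, metric; simpl; f_equal; ring.
Qed.

(** * Paths and the Riemannian distance *)

(** With [is_RInt] rather than [RInt], integrability of the speed travels with the length, so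
    lengths simply add under gluing. *)
Definition path (alpha a b : R) (c : R -> triple) (L : R) : Prop :=
  a < b /\ piecewise_C1 a b c /\ is_RInt (speed alpha c) a b L.

Lemma riem_dist_le (alpha a b L : R) (c : R -> triple) :
  path alpha a b c L -> Rbar_le (riem_dist alpha (c a) (c b)) (Finite L).
Proof.
intros (Hab & Hc & HL).
apply (proj1 (Glb_Rbar_correct _)).
exists a, b, c; repeat split; auto.
symmetry; apply is_RInt_unique, HL.
Qed.

Lemma locally_between (a b t : R) :
  a < t < b -> locally t (fun s => a < s < b).
Proof.
intros [H1 H2].
apply filter_and; [apply (open_gt a) | apply (open_lt b)]; assumption.
Qed.

Lemma velocity_ext (a b : R) (c d : R -> triple) (k : axis) (t : R) :
  (forall s, a < s < b -> c s = d s) -> a < t < b ->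
  velocity c k t = velocity d k t.
Proof.
intros H Ht; apply Derive_ext_loc.
apply filter_imp with (2 := locally_between _ _ _ Ht).
intros s Hs; rewrite (H s Hs); reflexivity.
Qed.

Lemma speed_ext (alpha a b : R) (c d : R -> triple) (t : R) :
  (forall s, a < s < b -> c s = d s) -> a < t < b ->
  speed alpha c t = speed alpha d t.
Proof.
intros H Ht; rewrite !speedE, (H t Ht).
rewrite !(velocity_ext a b c d _ t H Ht); reflexivity.
Qed.

Lemma path_single (alpha a b L : R) (d : R -> triple) :
  a < b -> C1_curve d -> is_RInt (speed alpha d) a b L ->
  path alpha a b d L.
Proof.
intros Hab Hd HL; repeat split; auto.
exists 1%nat, (fun m => match m with O => a | _ => b end).
repeat split; auto.
- replace m with O by lia; assumption.
- exists d; auto.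
Qed.

Definition glue (c d : R -> triple) (b t : R) : triple :=
  if Rle_dec t b then c t else d t.

Lemma glue_l (c d : R -> triple) (b t : R) : t <= b -> glue c d b t = c t.
Proof. unfold glue; destruct (Rle_dec t b); intros; [reflexivity | lra]. Qed.

Lemma glue_r (c d : R -> triple) (b t : R) :
  c b = d b -> b <= t -> glue c d b t = d t.
Proof.
unfold glue; destruct (Rle_dec t b); intros H Hb; [ | reflexivity].
replace t with b by lra; assumption.
Qed.

Lemma nodes_le (s : nat -> R) (n m : nat) :
  (forall i, (i < n)%nat -> s i < s (S i)) -> (m <= n)%nat -> s m <= s n.
Proof.
intros H Hm; induction Hm as [ | n Hm IH]; [lra | ].
apply Rle_trans with (s n); [apply IH; intros; apply H; lia | ].
apply Rlt_le, H; lia.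
Qed.

(** Broken paths are built from left to right, one [C^1] piece at a time. Speeds are compared only
    on open intervals, so the corner at [b] is harmless. *)
Lemma path_glue (alpha a b b' L L' : R) (c d : R -> triple) :
  path alpha a b c L -> b < b' -> C1_curve d -> c b = d b ->
  is_RInt (speed alpha d) b b' L' ->
  path alpha a b' (glue c d b) (L + L').
Proof.
intros (Hab & (n & s & Hs0 & Hsn & Hs) & HL) Hb Hd Hcd HL'.
repeat split; [lra | | ].
- exists (S n), (fun m => if le_dec m n then s m else b').
  repeat split.
  + destruct (le_dec 0 n); [assumption | lia].
  + destruct (le_dec (S n) n); [lia | reflexivity].
  + destruct (le_dec m n); [ | lia].
    destruct (le_dec (S m) n); [apply Hs; lia | ].
    replace m with n by lia; lra.
  + destruct (le_dec m n); [ | lia].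
    destruct (le_dec (S m) n) as [Hm | Hm].
    * destruct (Hs m Hm) as (_ & e & He & Hce).
      exists e; split; [assumption | intros t Ht].
      (* All earlier nodes are at most [s n = b], so the glued curve is still [c] on this piece. *)
      rewrite glue_l; [apply Hce, Ht | ].
      apply Rle_trans with (1 := proj2 Ht).
      rewrite <- Hsn; apply nodes_le; [intros; apply Hs | ]; auto.
    * exists d; split; [assumption | intros t Ht].
      apply glue_r; [assumption | ].
      replace m with n in Ht by lia; lra.
- apply @is_RInt_Chasles with b.
  + apply is_RInt_ext with (2 := HL).
    rewrite Rmin_left, Rmax_right by lra.
    intros t Ht; apply (speed_ext alpha a b); [ | assumption].
    intros u Hu; rewrite glue_l; [reflexivity | lra].
  + apply is_RInt_ext with (2 := HL').
    rewrite Rmin_left, Rmax_right by lra.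
    intros t Ht; apply (speed_ext alpha b b'); [ | assumption].
    intros u Hu; rewrite glue_r; [reflexivity | assumption | lra].
Qed.

Lemma is_RInt_eq_const (f : R -> R) (a b k : R) :
  a <= b -> (forall t, a < t < b -> f t = k) -> is_RInt f a b ((b - a) * k).
Proof.
intros Hab Hf.
apply is_RInt_ext with (fun _ => k); [ | exact (is_RInt_const a b k)].
rewrite Rmin_left, Rmax_right by lra.
intros t Ht; symmetry; apply Hf, Ht.
Qed.

Lemma C1_curve_of_derive (d d' : R -> triple) :
  (forall t k, is_derive (fun s => coord k (d s)) t (coord k (d' t)) /\
               continuous (fun s => coord k (d' s)) t) ->
  C1_curve d /\ forall t k, velocity d k t = coord k (d' t).
Proof.
intros H.
assert (Hv : forall t k, velocity d k t = coord k (d' t))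
  by (intros t k; apply is_derive_unique, H).
split; [ | assumption].
intros t k; split; [exists (coord k (d' t)); apply H | ].
apply continuous_ext with (2 := proj2 (H t k)).
intros s; symmetry; apply Hv.
Qed.

(** A geodesic is controlled only near its interval, whereas [C1_curve] concerns the whole line;
    beyond [a] and [b] the curve is continued along its tangent lines. *)
Lemma C1_extension (a b : R) (c : R -> triple) :
  a <= b ->
  (forall t k, a <= t <= b ->
     ex_derive (fun s => coord k (c s)) t /\ continuous (velocity c k) t) ->
  exists d, C1_curve d /\ forall t, a <= t <= b -> d t = c t.
Proof.
intros Hab Hc.
set (g k := extension_C1 (fun s => coord k (c s)) (velocity c k) a b).
set (g' k := extension_C0 (velocity c k) a b).
exists (fun t => (g ax t, g ay t, g az t)); split.
- apply (C1_curve_of_derive _ (fun t => (g' ax t, g' ay t, g' az t))).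
  assert (H : forall t k, is_derive (g k) t (g' k t) /\ continuous (g' k) t).
  { intros t k; split.
    - apply extension_C1_is_derive; [exact Hab | ].
      intros x H1 H2; apply Derive_correct, Hc; split; assumption.
    - apply extension_C0_continuous; [exact Hab | ].
      intros x H1 H2; apply Hc; split; assumption. }
  intros t []; apply H.
- intros t [H1 H2]; apply triple_eq.
  intros k; transitivity (g k t); [destruct k; reflexivity | ].
  exact (extension_C1_ext (fun s => coord k (c s)) _ a b t H1 H2).
Qed.

(** * The flow of [Sigma] *)

Lemma derive_le_0_decr (f f' : R -> R) (a b : R) :
  a <= b -> (forall t, a <= t <= b -> is_derive f t (f' t)) ->
  (forall t, a <= t <= b -> f' t <= 0) -> f b <= f a.
Proof.
intros Hab Hf Hf'.
destruct (MVT_gen f a b f') as (x & Hx & E);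
  rewrite ?Rmin_left, ?Rmax_right in * by lra.
- intros x Hx; apply Hf; lra.
- intros x Hx; apply derivable_continuous_pt.
  exists (f' x); apply is_derive_Reals, Hf, Hx.
- assert (H := Hf' x Hx); nra.
Qed.

Lemma derive_const_affine (f : R -> R) (m a b : R) :
  a <= b -> (forall t, a <= t <= b -> is_derive f t m) ->
  f b = f a + m * (b - a).
Proof.
intros Hab Hf.
destruct (MVT_gen f a b (fun _ => m)) as (x & _ & E);
  rewrite ?Rmin_left, ?Rmax_right in * by lra; [ | | lra].
- intros x Hx; apply Hf; lra.
- intros x Hx; apply derivable_continuous_pt.
  exists m; apply is_derive_Reals, Hf, Hx.
Qed.

Lemma derive_0_const (f : R -> R) (a b : R) :
  a <= b -> (forall t, a <= t <= b -> is_derive f t 0) -> f b = f a.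
Proof. intros Hab Hf; rewrite (derive_const_affine f 0 a b Hab Hf); ring. Qed.

(** The velocity of a geodesic segment is known to follow [Sigma] only on [[0, T]], while
    [integral_curve] asks for all times. *)
Definition integral_curve_on (alpha b : R) (u : R -> triple) : Prop :=
  forall t k, 0 <= t <= b ->
    is_derive (fun s => coord k (u s)) t (coord k (Sigma alpha (u t))).

Lemma coord_Sigma (alpha : R) (p : triple) (k : axis) :
  coord k (Sigma alpha p) =
  match k with
  | ax => coord ax p * coord az p
  | ay => - alpha * coord ay p * coord az p
  | az => alpha * coord ay p ^ 2 - coord ax p ^ 2
  end.
Proof. destruct p as [[x y] z], k; reflexivity. Qed.

Lemma is_derive_sqr (f : R -> R) (t l : R) :
  is_derive f t l -> is_derive (fun s => f s ^ 2) t (2 * f t * l).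
Proof.
intros H.
replace (2 * f t * l) with (INR 2 * l * f t ^ Nat.pred 2)
  by (simpl; ring).
apply (is_derive_pow f 2 t l H).
Qed.

Lemma unit_sphereE (p : triple) :
  unit_sphere p <-> sum_axes (fun k => coord k p ^ 2) = 1.
Proof. destruct p as [[x y] z]; unfold sum_axes; simpl; tauto. Qed.

(** [Sigma] is orthogonal to the position vector, so the Euclidean norm is constant along its
    flow. *)
Lemma sphere_invariant (alpha b t : R) (u : R -> triple) :
  integral_curve_on alpha b u -> unit_sphere (u 0) -> 0 <= t <= b ->
  unit_sphere (u t).
Proof.
intros Hu H0 Ht.
apply unit_sphereE in H0; apply unit_sphereE; rewrite <- H0.
apply (derive_0_const (fun s => sum_axes (fun k => coord k (u s) ^ 2)));
  [lra | intros s Hs].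
assert (H : forall k, is_derive (fun r => coord k (u r) ^ 2) s
          (2 * coord k (u s) * coord k (Sigma alpha (u s))))
  by (intros k; apply is_derive_sqr, Hu; lra).
replace 0 with
  (sum_axes (fun k => 2 * coord k (u s) * coord k (Sigma alpha (u s))))
  by (unfold sum_axes; rewrite !coord_Sigma; ring).
exact (is_derive_plus _ _ _ _ _
  (is_derive_plus _ _ _ _ _ (H ax) (H ay)) (H az)).
Qed.

(* Gronwall: on the unit sphere [|u - w| ^ 2] grows at most like [exp (4 * t)]. *)
Lemma integral_curve_unique (alpha b t : R) (u w : R -> triple) :
  0 < alpha <= 1 -> integral_curve_on alpha b u -> integral_curve_on alpha b w ->
  unit_sphere (u 0) -> u 0 = w 0 -> 0 <= t <= b -> u t = w t.
Proof.
intros Ha Hu Hw H0 E0 Ht.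
set (D s := sum_axes (fun k => (coord k (u s) - coord k (w s)) ^ 2)).
set (D' s := sum_axes (fun k => 2 * (coord k (u s) - coord k (w s)) *
   (coord k (Sigma alpha (u s)) - coord k (Sigma alpha (w s))))).
assert (HD : forall s, 0 <= s <= b -> is_derive D s (D' s)).
{ intros s Hs.
  assert (H : forall k, is_derive (fun r => (coord k (u r) - coord k (w r)) ^ 2) s
    (2 * (coord k (u s) - coord k (w s)) *
   (coord k (Sigma alpha (u s)) - coord k (Sigma alpha (w s))))).
  { intros k; apply (is_derive_sqr (fun r => coord k (u r) - coord k (w r))).
    exact (is_derive_minus _ _ _ _ _ (Hu s k Hs) (Hw s k Hs)). }
  exact (is_derive_plus _ _ _ _ _
    (is_derive_plus _ _ _ _ _ (H ax) (H ay)) (H az)). }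
assert (HD' : forall s, 0 <= s <= b -> D' s <= 4 * D s).
{ intros s Hs.
  assert (Su : unit_sphere (u s)) by (apply (sphere_invariant alpha b); auto).
  apply unit_sphereE in Su.
  unfold D, D', sum_axes in *; rewrite !coord_Sigma.
  revert Su.
  generalize (coord ax (u s)), (coord ay (u s)), (coord az (u s)),
    (coord ax (w s)), (coord ay (w s)), (coord az (w s)).
  intros x y z x' y' z' Su.
  (* In the differences [p], [q], [r] the cubic terms of [D'] cancel, leaving [2 * (p ^ 2 * z -
     alpha * q ^ 2 * z + alpha * y * q * r - x * p * r)]. [K1] to [K4] bound these four terms. *)
  set (p := x - x'); set (q := y - y'); set (r := z - z').
  replace x' with (x - p) by (unfold p; ring).
  replace y' with (y - q) by (unfold q; ring).
  replace z' with (z - r) by (unfold r; ring).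
  assert (Hx : -1 <= x <= 1) by (split; nra).
  assert (Hy : -1 <= y <= 1) by (split; nra).
  assert (Hz : -1 <= z <= 1) by (split; nra).
  assert (Hay : -1 <= alpha * y <= 1) by (split; nra).
  assert (Haz : -1 <= alpha * z <= 1) by (split; nra).
  assert (K1 : p ^ 2 * z <= p ^ 2) by nra.
  assert (K2 : - q ^ 2 * (alpha * z) <= q ^ 2) by nra.
  assert (K3 : 2 * (q * r) * (alpha * y) <= q ^ 2 + r ^ 2).
  { assert (0 <= (1 + alpha * y) * (q - r) ^ 2)
      by (apply Rmult_le_pos; [lra | apply pow2_ge_0]).
    assert (0 <= (1 - alpha * y) * (q + r) ^ 2)
      by (apply Rmult_le_pos; [lra | apply pow2_ge_0]).
    nra. }
  assert (K4 : - 2 * (p * r) * x <= p ^ 2 + r ^ 2).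
  { assert (0 <= (1 + x) * (p + r) ^ 2)
      by (apply Rmult_le_pos; [lra | apply pow2_ge_0]).
    assert (0 <= (1 - x) * (p - r) ^ 2)
      by (apply Rmult_le_pos; [lra | apply pow2_ge_0]).
    nra. }
  nra. }
assert (HE : D t * exp (- 4 * t) <= D 0 * exp (- 4 * 0)).
{ apply (derive_le_0_decr (fun s => D s * exp (- 4 * s))
     (fun s => D' s * exp (- 4 * s) + D s * (- 4 * exp (- 4 * s))));
    [lra | | ]; intros s Hs.
  - assert (He : is_derive (fun r => exp (- 4 * r)) s (- 4 * exp (- 4 * s)))
      by (auto_derive; auto; ring).
    refine (is_derive_mult D _ s _ _ (HD s _) He _); [lra | ].
    intros; apply Rmult_comm.
  - assert (H := HD' s ltac:(lra)); assert (P := exp_pos (- 4 * s)); nra. }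
replace (D 0) with 0 in HE by (unfold D, sum_axes; rewrite E0; ring).
assert (P := exp_pos (- 4 * t)).
assert (D t <= 0) by nra.
unfold D, sum_axes in *.
apply triple_eq; intros k.
apply Rminus_diag_uniq.
assert (forall x y z, x ^ 2 + y ^ 2 + z ^ 2 <= 0 -> x = 0 /\ y = 0 /\ z = 0)
  as S by (intros; repeat split; nra).
apply S in H; destruct k; tauto.
Qed.

Lemma integral_curve_shift (alpha s : R) (u : R -> triple) :
  integral_curve alpha u -> integral_curve alpha (fun t => u (t + s)).
Proof.
intros Hu t k.
replace (coord k (Sigma alpha (u (t + s))))
  with (scal 1 (coord k (Sigma alpha (u (t + s))))) by apply Rmult_1_l.
apply (is_derive_comp (fun r => coord k (u r)) (fun r => r + s));
  [apply Hu | auto_derive; auto].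
Qed.

Lemma integral_curve_sub (alpha b : R) (u : R -> triple) :
  integral_curve alpha u -> integral_curve_on alpha b u.
Proof. intros Hu t k _; apply Hu. Qed.

(** * The velocity of a geodesic in the left-invariant frame *)

Definition frame_velocity (alpha : R) (c : R -> triple) (t : R) : triple :=
  (exp (- coord az (c t)) * velocity c ax t,
   exp (alpha * coord az (c t)) * velocity c ay t,
   velocity c az t).

Lemma is_derive_frame (beta : R) (f z : R -> R) (t f' z' : R) :
  is_derive f t f' -> is_derive z t z' ->
  is_derive (fun s => exp (beta * z s) * f s) t
    (beta * z' * exp (beta * z t) * f t + exp (beta * z t) * f').
Proof.
intros Hf Hz.
assert (He : is_derive (fun s => exp (beta * z s)) t
               (beta * z' * exp (beta * z t))).
{ apply (is_derive_comp exp (fun s => beta * z s)).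
  - apply is_derive_exp.
  - exact (is_derive_scal z t beta z' Hz). }
apply (is_derive_mult _ f t _ _ He Hf).
intros; apply Rmult_comm.
Qed.

Lemma geodesic_derive (alpha T : R) (v : triple) (c : R -> triple)
    (t : R) (k : axis) :
  geodesic_segment alpha T v c ->
  0 <= t <= T -> is_derive (fun s => coord k (c s)) t (velocity c k t).
Proof.
intros Hc Ht; destruct Hc as (_ & _ & (eps & He & Hg) & _).
apply Derive_correct, (Hg t k); lra.
Qed.

Lemma frame_velocity_0 (alpha T : R) (v : triple) (c : R -> triple) :
  geodesic_segment alpha T v c -> frame_velocity alpha c 0 = v.
Proof.
intros (_ & _ & _ & H0).
apply triple_eq; intros k; generalize (H0 k).
assert (E1 := exp_mul_opp (coord az (c 0))).
assert (E2 := exp_mul_opp (alpha * coord az (c 0))).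
destruct v as [[x y] z], k; simpl; intros ->.
- rewrite <- (Rmult_1_r x) at 2; rewrite <- E1; ring.
- rewrite <- (Rmult_1_r y) at 2; rewrite <- E2.
  replace (- alpha * coord az (c 0)) with (- (alpha * coord az (c 0))) by ring.
  ring.
- reflexivity.
Qed.

(** Differentiating the factors [exp (- z)] and [exp (alpha z)] cancels half of the right-hand sides
    [2 x' z'] and [- 2 alpha y' z'] of the geodesic equations; what is left is [Sigma]. *)
Lemma frame_velocity_integral (alpha T : R) (v : triple) (c : R -> triple) :
  geodesic_segment alpha T v c ->
  integral_curve_on alpha T (frame_velocity alpha c).
Proof.
intros Hc t k Ht; rewrite coord_Sigma.
assert (Dz := geodesic_derive alpha T v c t az Hc Ht).
destruct Hc as (_ & _ & (eps & He & Hg) & _).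
destruct (geodesic_equation alpha _ _ c t Hg) as (Hx & Hy & Hz); [lra | ].
destruct k; unfold frame_velocity; simpl.
- refine (is_derive_ext _ _ _ _ _ (_ : is_derive (fun s =>
    exp (- 1 * coord az (c s)) * velocity c ax s) _ _)).
  { intros s; do 2 f_equal; ring. }
  replace (- coord az (c t)) with (- 1 * coord az (c t)) by ring.
  match goal with |- is_derive _ _ ?l => replace l with
    (- 1 * velocity c az t * exp (- 1 * coord az (c t)) * velocity c ax t
     + exp (- 1 * coord az (c t)) * (2 * velocity c ax t * velocity c az t))
    by ring end.
  apply (is_derive_frame (- 1) _ (fun s => coord az (c s))); assumption.
- match goal with |- is_derive _ _ ?l => replace l with
    (alpha * velocity c az t * exp (alpha * coord az (c t)) * velocity c ay t
     + exp (alpha * coord az (c t))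
       * (- 2 * alpha * velocity c ay t * velocity c az t)) by ring end.
  apply (is_derive_frame alpha _ (fun s => coord az (c s))); assumption.
- assert (E1 : exp (2 * alpha * coord az (c t)) = exp (alpha * coord az (c t)) ^ 2).
  { simpl; rewrite Rmult_1_r, <- exp_plus; f_equal; ring. }
  assert (E2 : exp (- 2 * coord az (c t)) = exp (- coord az (c t)) ^ 2).
  { simpl; rewrite Rmult_1_r, <- exp_plus; f_equal; ring. }
  rewrite E1, E2 in Hz.
  match goal with |- is_derive _ _ ?l =>
    match type of Hz with is_derive _ _ ?m => replace l with m by ring end end.
  exact Hz.
Qed.

Lemma frame_velocity_sphere (alpha T : R) (v : triple) (c : R -> triple) (t : R) :
  geodesic_segment alpha T v c ->
  0 <= t <= T -> unit_sphere (frame_velocity alpha c t).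
Proof.
intros Hc; apply sphere_invariant with alpha.
- exact (frame_velocity_integral alpha T v c Hc).
- rewrite (frame_velocity_0 alpha T v c Hc); apply Hc.
Qed.

(** The frame is orthonormal, so the speed is the Euclidean norm of [frame_velocity]. *)
Lemma geodesic_unit_speed (alpha T : R) (v : triple) (c : R -> triple) (t : R) :
  geodesic_segment alpha T v c -> 0 <= t <= T -> speed alpha c t = 1.
Proof.
intros Hc Ht; rewrite speedE, <- sqrt_1; f_equal.
generalize (frame_velocity_sphere alpha T v c t Hc Ht); simpl; intros E.
etransitivity; [ | exact E].
replace (- 2 * coord az (c t)) with (- coord az (c t) + - coord az (c t)) by ring.
replace (2 * alpha * coord az (c t))
  with (alpha * coord az (c t) + alpha * coord az (c t)) by ring.
rewrite !exp_plus; ring.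
Qed.

Lemma geodesic_length (alpha T : R) (v : triple) (c : R -> triple) :
  geodesic_segment alpha T v c -> curve_length alpha c 0 T = T.
Proof.
intros Hc; assert (HT : 0 < T) by apply Hc.
apply is_RInt_unique.
replace T with ((T - 0) * 1) at 2 by ring.
apply is_RInt_eq_const; [lra | ].
intros; apply (geodesic_unit_speed alpha T v); [assumption | lra].
Qed.

Lemma geodesic_C1_extension (alpha T : R) (v : triple) (c : R -> triple) :
  geodesic_segment alpha T v c ->
  exists d, C1_curve d /\ forall t, 0 <= t <= T -> d t = c t.
Proof.
intros (HT & _ & (eps & He & Hg) & _).
apply C1_extension; [lra | ].
intros t k Ht; destruct (Hg t k) as [H1 H2]; [lra | ].
split; [assumption | ].
apply @ex_derive_continuous; eexists; exact H2.
Qed.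

(** * Equilibria: second variation *)

(* [exp (- x) * (1 + x + x ^ 2 / 2 + x ^ 3 / 6)] has derivative
   [- exp (- x) * x ^ 3 / 6], hence its maximum at [0]. *)
Lemma exp_ge_cubic (r : R) : 1 + r + r ^ 2 / 2 + r ^ 3 / 6 <= exp r.
Proof.
set (h x := exp (- x) * (1 + x + x ^ 2 / 2 + x ^ 3 / 6)).
set (h' x := - (exp (- x) * x ^ 3 / 6)).
assert (Hh : forall x, is_derive h x (h' x)).
{ intros x; unfold h, h'; auto_derive; [auto | simpl; field]. }
destruct (MVT_gen h 0 r h') as (x & Hx & E).
- intros x _; apply Hh.
- intros x _; apply derivable_continuous_pt.
  exists (h' x); apply is_derive_Reals, Hh.
- assert (P := exp_pos (- x)).
  (* [x] lies between [0] and [r], whatever the sign of [r]; hence [h' x * r <= 0]. *)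
  assert (Hxr : 0 <= x * r).
  { unfold Rmin, Rmax in Hx; destruct (Rle_dec 0 r); nra. }
  assert (K : h r <= 1).
  { replace 1 with (h 0) by (unfold h; rewrite Ropp_0, exp_0; field).
    assert (0 <= exp (- x) * (x ^ 2 * (x * r)))
      by (apply Rmult_le_pos; [lra | apply Rmult_le_pos; [apply pow2_ge_0 | lra]]).
    unfold h' in E; nra. }
  assert (P' := exp_pos r); assert (M := exp_mul_opp r).
  unfold h in K.
  rewrite <- (Rmult_1_r (exp r)).
  apply Rle_trans with (2 := Rmult_le_compat_l _ _ _ (Rlt_le _ _ P') K).
  rewrite <- Rmult_assoc, M; lra.
Qed.

(** The left side is [1 + r - r ^ 2 / 2] up to third order, and the slack [rho * r ^ 2] absorbs the
    remainder. *)
Lemma exp_opp_sqr_le (r rho : R) :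
  0 < rho <= 1 / 2 -> - rho <= r <= rho ->
  exp (- r) * (1 + r) ^ 2 <= 1 + r - (1 / 2 - rho) * r ^ 2.
Proof.
intros Hrho Hr.
assert (C := exp_ge_cubic r).
assert (P := exp_pos (- r)); assert (M := exp_mul_opp r).
assert (Hpos : 0 <= 1 + r - (1 / 2 - rho) * r ^ 2) by nra.
assert (K : (1 + r) ^ 2 <=
  (1 + r - (1 / 2 - rho) * r ^ 2) * (1 + r + r ^ 2 / 2 + r ^ 3 / 6)).
(* [r ^ 2] times this expression is the right side of [K] minus its left side. *)
{ assert (F : 0 <= rho + (1 / 6 + rho) * r + (- 1 / 12 + rho / 2) * r ^ 2
                    - (1 / 2 - rho) / 6 * r ^ 3).
  { assert (r ^ 2 <= rho ^ 2) by nra.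
    assert (- rho * (1 / 2) <= rho * r) by nra.
    assert (r ^ 3 <= rho ^ 3).
    { assert (0 <= (rho - r) * (rho ^ 2 + rho * r + r ^ 2))
        by (apply Rmult_le_pos; nra). nra. }
    assert (rho ^ 2 <= rho / 2) by nra.
    assert (rho ^ 3 <= rho / 4) by (simpl in *; nra).
    assert ((1 / 2 - rho) / 6 * r ^ 3 <= rho / 48) by nra.
    nra. }
  assert (G := Rmult_le_pos _ _ (pow2_ge_0 r) F); nra. }
apply Rle_trans with
  (exp (- r) * ((1 + r - (1 / 2 - rho) * r ^ 2) * exp r)); [ | nra].
apply Rmult_le_compat_l; [lra | ].
apply Rle_trans with (1 := K), Rmult_le_compat_l; assumption.
Qed.

(* A sine wave of amplitude [e] in [z] around the geodesic of constant velocity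
   [(x, y, 0)] through [p]; the other corrections keep both horizontal momenta
   [exp (- 2 z) x'] and [exp (2 alpha z) y'] constant to first order in [e]. *)
Definition wave_curve (alpha x y w e : R) (p : triple) (t : R) : triple :=
  (coord ax p + exp (coord az p) * x * (t + 2 * e * ((1 - cos (w * t)) / w)),
   coord ay p + exp (- alpha * coord az p) * y
                * (t - 2 * alpha * e * ((1 - cos (w * t)) / w)),
   coord az p + e * sin (w * t)).

Definition wave_velocity (alpha x y w e : R) (p : triple) (t : R) : triple :=
  (exp (coord az p) * x * (1 + 2 * e * sin (w * t)),
   exp (- alpha * coord az p) * y * (1 - 2 * alpha * e * sin (w * t)),
   e * w * cos (w * t)).

Lemma wave_curve_C1 (alpha x y w e : R) (p : triple) :
  w <> 0 ->
  C1_curve (wave_curve alpha x y w e p) /\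
  forall t k, velocity (wave_curve alpha x y w e p) k t
              = coord k (wave_velocity alpha x y w e p t).
Proof.
intros Hw; apply C1_curve_of_derive; intros t k; split.
- destruct k; simpl; auto_derive; auto; field; assumption.
- apply @ex_derive_continuous; destruct k; simpl; auto_derive; auto.
Qed.

(** The base point drops out by left invariance. Both horizontal terms are put in the form
    [exp (- r) * (1 + r) ^ 2] of [exp_opp_sqr_le], which explains the double negation. *)
Lemma wave_speedE (alpha x y w e t : R) (p : triple) :
  w <> 0 ->
  speed alpha (wave_curve alpha x y w e p) t =
  sqrt (x ^ 2 * (exp (- (2 * e * sin (w * t))) * (1 + 2 * e * sin (w * t)) ^ 2)
        + y ^ 2 * (exp (- - (2 * alpha * e * sin (w * t)))
                   * (1 + - (2 * alpha * e * sin (w * t))) ^ 2)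
        + (e * w * cos (w * t)) ^ 2).
Proof.
intros Hw.
destruct (wave_curve_C1 alpha x y w e p Hw) as [_ Hv].
rewrite speedE, !Hv; f_equal; simpl.
set (S := sin (w * t)); set (z := coord az p).
replace (- 2 * (z + e * S)) with (- z + - z + - (2 * e * S)) by ring.
replace (2 * alpha * (z + e * S))
  with (alpha * z + alpha * z + - - (2 * alpha * e * S)) by ring.
replace (- alpha * z) with (- (alpha * z)) by ring.
rewrite !exp_plus, !exp_Ropp.
assert (P1 := exp_pos z); assert (P2 := exp_pos (alpha * z)).
assert (P3 := exp_pos (2 * e * S)); assert (P4 := exp_pos (2 * alpha * e * S)).
field; lra.
Qed.

(* The linear term in [e] vanishes because [x ^ 2 = alpha * y ^ 2], and
   [x ^ 2 + alpha ^ 2 * y ^ 2 = alpha]. *)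
Lemma wave_speed_le (alpha x y w e t : R) (p : triple) :
  0 < alpha <= 1 -> w <> 0 -> 0 < e <= 1 / 4 ->
  x ^ 2 = alpha * y ^ 2 -> x ^ 2 + y ^ 2 = 1 ->
  speed alpha (wave_curve alpha x y w e p) t <=
  1 - (1 - 4 * e) * alpha * e ^ 2 * sin (w * t) ^ 2
  + e ^ 2 * w ^ 2 * cos (w * t) ^ 2 / 2.
Proof.
intros Ha Hw He Hxy H1.
rewrite wave_speedE by assumption.
set (S := sin (w * t)); set (C := cos (w * t)).
assert (HS : -1 <= S <= 1) by apply SIN_bound.
assert (B1 : - (2 * e) <= 2 * e * S <= 2 * e) by (split; nra).
assert (B2 : - (2 * e) <= - (2 * alpha * e * S) <= 2 * e).
{ assert (-1 <= alpha * S <= 1) by (split; nra). split; nra. }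
(* Here [rho = 2 * e], which is at most [1 / 2] since [e <= 1 / 4]. *)
assert (K1 := exp_opp_sqr_le (2 * e * S) (2 * e) ltac:(lra) B1).
assert (K2 := exp_opp_sqr_le (- (2 * alpha * e * S)) (2 * e) ltac:(lra) B2).
assert (M1 := Rmult_le_compat_l _ _ _ (pow2_ge_0 x) K1).
assert (M2 := Rmult_le_compat_l _ _ _ (pow2_ge_0 y) K2).
match goal with |- sqrt ?Q <= _ => set (q := Q) in * end.
assert (Hq : q <= 1 - (2 - 8 * e) * alpha * e ^ 2 * S ^ 2 + e ^ 2 * w ^ 2 * C ^ 2).
{ unfold q.
  eapply Rle_trans;
    [apply Rplus_le_compat_r, Rplus_le_compat; [exact M1 | exact M2] | ].
  apply Req_le.
  replace (x ^ 2) with (alpha * y ^ 2) in * by lra.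
  replace (y ^ 2) with (/ (1 + alpha)) by (field_simplify_eq; lra).
  field; lra. }
assert (Hq0 : 0 <= q).
{ assert (P : forall r s k, 0 <= r ^ 2 * (exp s * k ^ 2)).
  { intros r s k; assert (E := exp_pos s).
    apply Rmult_le_pos; [apply pow2_ge_0 | ].
    apply Rmult_le_pos; [lra | apply pow2_ge_0]. }
  apply Rplus_le_le_0_compat; [ | apply pow2_ge_0].
  apply Rplus_le_le_0_compat; apply P. }
(* [sqrt q <= (1 + q) / 2], by expanding [(sqrt q - 1) ^ 2 >= 0]. *)
assert (R := pow2_sqrt q Hq0); assert (D := pow2_ge_0 (sqrt q - 1)); nra.
Qed.

(** Over one full wave, [w * T = 2 * PI], the functions [sin ^ 2] and [cos ^ 2] both have mean
    [1 / 2]. *)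
Lemma wave_length (alpha x y e T : R) (p : triple) :
  0 < alpha <= 1 -> 0 < T -> 0 < e <= 1 / 4 ->
  x ^ 2 = alpha * y ^ 2 -> x ^ 2 + y ^ 2 = 1 ->
  exists L, path alpha 0 T (wave_curve alpha x y (2 * PI / T) e p) L /\
    L <= T * (1 + e ^ 2 / 2 * ((2 * PI / T) ^ 2 / 2 - (1 - 4 * e) * alpha)).
Proof.
intros Ha HT He Hxy H1.
assert (HPI := PI_RGT_0).
set (w := 2 * PI / T).
assert (Hw : w <> 0).
{ apply Rgt_not_eq; unfold w; apply Rdiv_lt_0_compat; lra. }
assert (HwT : w * T = 2 * PI) by (unfold w; field; lra).
set (d := wave_curve alpha x y w e p).
set (g t := 1 - (1 - 4 * e) * alpha * e ^ 2 * sin (w * t) ^ 2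
            + e ^ 2 * w ^ 2 * cos (w * t) ^ 2 / 2).
set (G t := t - (1 - 4 * e) * alpha * e ^ 2
                * (t / 2 - sin (w * t) * cos (w * t) / (2 * w))
            + e ^ 2 * w ^ 2 * (t / 2 + sin (w * t) * cos (w * t) / (2 * w)) / 2).
assert (HG : is_RInt g 0 T (minus (G T) (G 0))).
{ apply @is_RInt_derive.
  - intros t _; unfold G, g; auto_derive; [auto | ].
    assert (SC := sin2_cos2 (w * t)); unfold Rsqr in SC.
    set (S := sin (w * t)) in *; set (C := cos (w * t)) in *.
    assert (F : (w * 1 * C * C + S * (w * 1 * - S)) * / (2 * w) = C ^ 2 - 1 / 2).
    { transitivity ((C * C - S * S) / 2); [field; assumption | ].
      replace (S * S) with (1 - C * C) by lra; field. }
    rewrite F; replace (S ^ 2) with (1 - C ^ 2) by (simpl; lra); field.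
  - intros t _; apply @ex_derive_continuous; unfold g; auto_derive; auto. }
assert (Hs : ex_RInt (speed alpha d) 0 T).
{ apply @ex_RInt_continuous; intros t _.
  eapply continuous_ext; [intros s; symmetry; apply wave_speedE, Hw | ].
  apply (continuous_comp _ sqrt); [ | apply continuous_sqrt].
  apply @ex_derive_continuous; auto_derive; auto. }
exists (RInt (speed alpha d) 0 T); split.
- apply path_single; [assumption | apply wave_curve_C1, Hw | ].
  apply @RInt_correct, Hs.
- apply Rle_trans with (RInt g 0 T).
  + apply RInt_le; [lra | assumption | eexists; exact HG | ].
    intros t _; apply wave_speed_le; assumption.
  + rewrite (is_RInt_unique _ _ _ _ HG).
    unfold minus, plus, opp, G; simpl.
    rewrite HwT, sin_2PI, Rmult_0_r, sin_0.
    apply Req_le; field; assumption.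
Qed.

(** The full sine wave over [[0, T]] has the endpoints of the geodesic, and the bound on [T] makes
    its second-order change of length negative. *)
Lemma equilibrium_not_minimizing (alpha T : R) (v : triple) (c : R -> triple) :
  0 < alpha <= 1 -> geodesic_segment alpha T v c ->
  Sigma alpha v = (0, 0, 0) -> coord ax v * coord ay v <> 0 ->
  PI * sqrt 2 / sqrt alpha < T ->
  Rbar_lt (riem_dist alpha (c 0) (c T)) (Finite T).
Proof.
intros Ha Hc Hv Hxy HT.
assert (T0 : 0 < T) by apply Hc.
assert (HS : unit_sphere v) by apply Hc.
(* The constant curve at the zero [v] of [Sigma] is an integral curve, so uniqueness applies. *)
assert (W : forall t, 0 <= t <= T -> frame_velocity alpha c t = v).
{ intros t Ht.
  apply (integral_curve_unique alpha T t _ (fun _ => v)); auto.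
  - apply (frame_velocity_integral alpha T v c); assumption.
  - intros s k _; rewrite Hv.
    replace (coord k (0, 0, 0)) with 0 by (destruct k; reflexivity).
    apply @is_derive_const.
  - rewrite (frame_velocity_0 alpha T v c); assumption.
  - apply (frame_velocity_0 alpha T v c); assumption. }
assert (Dc := fun t k => geodesic_derive alpha T v c t k Hc).
destruct v as [[x y] z]; simpl in Hxy, HS.
injection Hv as Hx Hy Hz.
assert (z0 : z = 0) by (destruct (Rmult_integral _ _ Hx); [subst; lra | assumption]).
subst z.
assert (Zc : forall t, 0 <= t <= T -> coord az (c t) = coord az (c 0)).
{ intros t Ht.
  apply (derive_0_const (fun s => coord az (c s))); [lra | ].
  intros s Hs; replace 0 with (velocity c az s); [apply Dc; lra | ].
  assert (E := W s ltac:(lra)); injection E; auto. }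
assert (XT : coord ax (c T) = coord ax (c 0) + exp (coord az (c 0)) * x * (T - 0)).
{ apply (derive_const_affine (fun s => coord ax (c s))); [lra | intros s Hs].
  replace (exp (coord az (c 0)) * x) with (velocity c ax s); [apply Dc, Hs | ].
  assert (E := W s Hs); injection E as E _ _.
  rewrite <- E, (Zc s Hs), <- Rmult_assoc, exp_mul_opp; ring. }
assert (YT : coord ay (c T)
             = coord ay (c 0) + exp (- alpha * coord az (c 0)) * y * (T - 0)).
{ apply (derive_const_affine (fun s => coord ay (c s))); [lra | intros s Hs].
  replace (exp (- alpha * coord az (c 0)) * y) with (velocity c ay s);
    [apply Dc, Hs | ].
  assert (E := W s Hs); injection E as _ E _.
  rewrite <- E, (Zc s Hs).
  replace (- alpha * coord az (c 0)) with (- (alpha * coord az (c 0))) by ring.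
  rewrite <- Rmult_assoc, (Rmult_comm (exp (- _))), exp_mul_opp; ring. }
set (w := 2 * PI / T).
(* This is the hypothesis on [T], rewritten as [w < sqrt 2 * sqrt alpha]. *)
assert (Hw : w ^ 2 < 2 * alpha).
{ assert (P := PI_RGT_0).
  assert (S2 := pow2_sqrt 2 ltac:(lra)).
  assert (Sa := pow2_sqrt alpha ltac:(lra)).
  assert (0 < sqrt 2) by (apply sqrt_lt_R0; lra).
  assert (0 < sqrt alpha) by (apply sqrt_lt_R0; lra).
  assert (w < sqrt 2 * sqrt alpha).
  { unfold w; apply Rlt_div_l; [lra | ].
    apply Rlt_div_l in HT; [ | lra]. nra. }
  assert (0 < w) by (unfold w; apply Rdiv_lt_0_compat; lra).
  replace (2 * alpha) with ((sqrt 2 * sqrt alpha) ^ 2)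
    by (rewrite Rpow_mult_distr, S2, Sa; ring).
  nra. }
(* With this amplitude the bracket in [wave_length], [w ^ 2 / 2 - (1 - 4 * e) * alpha], equals
   [- 4 * alpha * e]. *)
set (e := (2 * alpha - w ^ 2) / (16 * alpha)).
assert (Ee : 16 * alpha * e = 2 * alpha - w ^ 2) by (unfold e; field; lra).
assert (He : 0 < e <= 1 / 4).
{ assert (0 <= w ^ 2) by apply pow2_ge_0. split; nra. }
destruct (wave_length alpha x y e T (c 0) Ha T0 He) as (L & HL & Hle);
  [lra | lra | ].
fold w in HL, Hle.
apply Rbar_le_lt_trans with (Finite L).
- replace (c 0) with (wave_curve alpha x y w e (c 0) 0).
  replace (c T) with (wave_curve alpha x y w e (c 0) T).
  + apply riem_dist_le, HL.
  + assert (HwT : w * T = 2 * PI) by (unfold w; field; lra).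
    apply triple_eq; intros []; unfold wave_curve;
      [rewrite XT | rewrite YT | rewrite (Zc T) by lra]; simpl; rewrite HwT.
    * rewrite cos_2PI; unfold Rdiv; ring.
    * rewrite cos_2PI; unfold Rdiv; ring.
    * rewrite sin_2PI; ring.
  + apply triple_eq; intros []; unfold wave_curve; simpl;
      rewrite Rmult_0_r, ?cos_0, ?sin_0; unfold Rdiv; ring.
- change (L < T); apply Rle_lt_trans with (1 := Hle).
  replace (w ^ 2 / 2 - (1 - 4 * e) * alpha) with (- (4 * alpha * e)) by lra.
  assert (0 < e ^ 2) by (apply pow_lt; lra).
  assert (0 < alpha * e) by (apply Rmult_lt_0_compat; lra).
  assert (0 < T * (e ^ 2 / 2 * (4 * alpha * e))); [ | lra].
  do 2 (apply Rmult_lt_0_compat; [lra | ]); lra.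
Qed.

(** * Loops: a shortcut through the rotated, reversed period *)

(** Filling in the difference quotient at [0] lets limits of expressions in it be taken by
    continuity. *)
Lemma slope_continuous (f : R -> R) (t l : R) :
  is_derive f t l ->
  continuous (fun h => if Req_EM_T h 0 then l else (f (t + h) - f t) / h) 0.
Proof.
intros H; apply is_derive_Reals in H.
apply filterlim_locally; intros eps.
destruct (H eps (cond_pos eps)) as [del Hdel].
exists del; intros h Hh.
destruct (Req_EM_T 0 0) as [_ | N]; [ | exfalso; apply N; reflexivity].
destruct (Req_EM_T h 0) as [_ | Hh0]; [apply ball_center | ].
apply Hdel; [assumption | ].
rewrite <- (Rminus_0_r h); exact Hh.
Qed.

Lemma locally_0_small (P : R -> Prop) (b : R) :
  0 < b -> locally 0 P -> exists h, 0 < h < b /\ P h.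
Proof.
intros Hb [del Hdel].
assert (Hd := cond_pos del).
exists (Rmin (b / 2) (del / 2)).
assert (0 < Rmin (b / 2) (del / 2)) by (apply Rmin_glb_lt; lra).
assert (H1 := Rmin_l (b / 2) (del / 2)); assert (H2 := Rmin_r (b / 2) (del / 2)).
split; [lra | apply Hdel].
change (Rabs (Rmin (b / 2) (del / 2) - 0) < del).
rewrite Rminus_0_r, Rabs_pos_eq; lra.
Qed.

(** The Riemannian norm of the coordinate vector [(mx, my, 0)] at height [z]. *)
Definition chord_speed (alpha z mx my : R) : R :=
  sqrt (exp (- 2 * z) * mx ^ 2 + exp (2 * alpha * z) * my ^ 2).

(* As [h] tends to [0] the chord speed tends to the length of the horizontal part
   of the unit velocity at [t]. *)
Lemma short_chord (alpha b t : R) (c : R -> triple) :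
  0 < b ->
  (forall k, is_derive (fun s => coord k (c s)) t (velocity c k t)) ->
  speed alpha c t = 1 -> velocity c az t <> 0 ->
  exists h, 0 < h < b /\
    chord_speed alpha (coord az (c (t + h)))
      ((coord ax (c (t + h)) - coord ax (c t)) / h)
      ((coord ay (c (t + h)) - coord ay (c t)) / h) < 1.
Proof.
intros Hb Dc Hs Hz.
set (Q k h := if Req_EM_T h 0 then velocity c k t
              else (coord k (c (t + h)) - coord k (c t)) / h).
assert (HQ : forall k, continuous (Q k) 0)
  by (intros k; exact (slope_continuous _ _ _ (Dc k))).
(* For [h <> 0] this is the square of the chord speed; at [h = 0] unit speed makes it [1] minus the
   square of the vertical velocity. *)
set (F h := exp (- 2 * coord az (c (t + h))) * (Q ax h * Q ax h)
            + exp (2 * alpha * coord az (c (t + h))) * (Q ay h * Q ay h)).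
assert (HZ : forall beta,
   continuous (fun h => exp (beta * coord az (c (t + h)))) 0).
{ intros beta; apply @ex_derive_continuous.
  exists (scal (scal 1 (scal beta (velocity c az t)))
            (exp (beta * coord az (c (t + 0))))).
  apply (is_derive_comp exp (fun h => beta * coord az (c (t + h)))).
  - apply is_derive_exp.
  - replace (scal 1 (scal beta (velocity c az t)))
      with (beta * (scal 1 (velocity c az t)))
      by (unfold scal; simpl; unfold mult; simpl; ring).
    apply is_derive_scal.
    apply (is_derive_comp (fun s => coord az (c s)) (fun h => t + h)).
    + rewrite Rplus_0_r; apply Dc.
    + auto_derive; auto. }
assert (HF : continuous F 0).
{ apply @continuous_plus; apply @continuous_mult; try apply HZ;
    apply @continuous_mult; apply HQ. }
assert (F0 : F 0 < 1).
{ unfold F, Q; destruct (Req_EM_T 0 0) as [_ | N];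
    [ | exfalso; apply N; reflexivity].
  rewrite Rplus_0_r.
  rewrite speedE in Hs.
  match type of Hs with sqrt ?q = 1 => assert (E : q = 1) end.
  { rewrite <- (pow1 2), <- Hs; symmetry; apply pow2_sqrt.
    repeat apply Rplus_le_le_0_compat; try apply pow2_ge_0;
      apply Rmult_le_pos; try apply pow2_ge_0; apply Rlt_le, exp_pos. }
  assert (0 < velocity c az t ^ 2)
    by (apply Rlt_le_trans with (Rsqr (velocity c az t));
        [apply Rsqr_pos_lt, Hz | unfold Rsqr; simpl; lra]).
  nra. }
destruct (locally_0_small (fun h => F h < 1) b Hb) as (h & Hh & HFh).
{ apply (HF (fun y => y < 1)), (open_lt 1), F0. }
exists h; split; [assumption | ].
unfold chord_speed; rewrite <- sqrt_1; apply sqrt_lt_1_alt; split.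
- apply Rplus_le_le_0_compat; apply Rmult_le_pos;
    try apply pow2_ge_0; apply Rlt_le, exp_pos.
- unfold F, Q in HFh; destruct (Req_EM_T h 0); [lra | ].
  simpl; rewrite !Rmult_1_r; exact HFh.
Qed.

(** Time reversal and the half turn [(X - x, Y - y, z)] each negate the horizontal velocity, so only
    the vertical one changes sign; the metric depends on [z] alone and sees only squares. *)
Lemma speed_reverse (alpha t : R) (c r : R -> triple) (s X Y : R) :
  (forall t, r t = (X - coord ax (c (s - t)), Y - coord ay (c (s - t)),
                    coord az (c (s - t)))) ->
  C1_curve c ->
  C1_curve r /\ forall t, speed alpha r t = speed alpha c (s - t).
Proof.
intros Hr Hc.
assert (D : forall t k, is_derive (fun t => coord k (c (s - t))) t
                          (- velocity c k (s - t))).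
{ intros u k.
  replace (- velocity c k (s - u)) with (scal (- 1) (velocity c k (s - u)))
    by (unfold scal; simpl; unfold mult; simpl; ring).
  apply (is_derive_comp (fun x => coord k (c x)) (fun x => s - x)).
  - apply Derive_correct, Hc.
  - auto_derive; auto; ring. }
assert (C : forall t k, continuous (fun t => velocity c k (s - t)) t).
{ intros u k; apply (continuous_comp (fun x => s - x)).
  - apply @ex_derive_continuous; auto_derive; auto.
  - apply Hc. }
destruct (C1_curve_of_derive r (fun t => (velocity c ax (s - t),
  velocity c ay (s - t), - velocity c az (s - t)))) as [Cr Vr].
{ intros u k; split.
  - apply is_derive_ext with (fun x => match k with
      | ax => X - coord ax (c (s - x)) | ay => Y - coord ay (c (s - x))
      | az => coord az (c (s - x)) end);
      [intros x; rewrite (Hr x); destruct k; reflexivity | ].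
    destruct k; simpl; [ | | apply D].
    + replace (velocity c ax (s - u)) with (0 - - velocity c ax (s - u)) by ring.
      apply @is_derive_minus; [apply @is_derive_const | apply D].
    + replace (velocity c ay (s - u)) with (0 - - velocity c ay (s - u)) by ring.
      apply @is_derive_minus; [apply @is_derive_const | apply D].
  - destruct k; simpl; [apply C | apply C | ].
    apply @continuous_opp, C. }
split; [assumption | intros u].
rewrite !speedE, !Vr, Hr; simpl; f_equal; ring.
Qed.

Lemma horizontal_line (alpha : R) (p : triple) (mx my t0 : R) :
  let d t := (coord ax p + mx * (t - t0), coord ay p + my * (t - t0),
              coord az p) in
  C1_curve d /\ forall t, speed alpha d t = chord_speed alpha (coord az p) mx my.
Proof.
intros d.
destruct (C1_curve_of_derive d (fun _ => (mx, my, 0))) as [Cd Vd].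
{ intros t k; split.
  - destruct k; simpl; auto_derive; auto; ring.
  - apply @continuous_const. }
split; [assumption | intros t].
unfold chord_speed; rewrite speedE, !Vd; unfold d; simpl; f_equal; ring.
Qed.

(** The shortcut has length [T - 2 * h * (1 - kappa)], where [kappa < 1] is the speed along the
    chord. *)
Lemma periodic_shortcut (alpha T delta s : R) (c : R -> triple) :
  0 < delta -> 0 < s -> delta + s < T -> C1_curve c ->
  (forall t, 0 < t < T -> speed alpha c t = 1) ->
  (forall t, 0 < t < T - s ->
     coord az (c (t + s)) = coord az (c t) /\
     forall k, velocity c k (t + s) = velocity c k t) ->
  velocity c az delta <> 0 ->
  Rbar_lt (riem_dist alpha (c 0) (c T)) (Finite T).
Proof.
intros Hd Hs HT Hc Hsp Hper Hz.
assert (Dc : forall t k, is_derive (fun x => coord k (c x)) t (velocity c k t))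
  by (intros t k; apply Derive_correct, Hc).
(* The two bounds on [h] give [delta < tau - h] and [tau + h < T]. *)
destruct (short_chord alpha (Rmin s (T - s - delta)) delta c)
  as (h & Hh & Hchord); auto.
{ apply Rmin_glb_lt; lra. }
{ apply Hsp; lra. }
assert (h < s) by (apply Rlt_le_trans with (1 := proj2 Hh), Rmin_l).
assert (h < T - s - delta) by (apply Rlt_le_trans with (1 := proj2 Hh), Rmin_r).
set (tau := delta + s).
set (mx := (coord ax (c (delta + h)) - coord ax (c delta)) / h) in *.
set (my := (coord ay (c (delta + h)) - coord ay (c delta)) / h) in *.
set (kappa := chord_speed alpha (coord az (c (delta + h))) mx my) in *.
(* The axis of the half turn passes through the midpoint of [c delta] and [c tau]; these have equal
   height, so the turn exchanges them. *)
set (r t := (coord ax (c delta) + coord ax (c tau) - coord ax (c (delta + tau - t)),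
             coord ay (c delta) + coord ay (c tau) - coord ay (c (delta + tau - t)),
             coord az (c (delta + tau - t)))).
(* By periodicity the chord from [r (tau - h)] to [c (tau + h)] has twice the horizontal
   displacement of [c] over [[delta, delta + h]], covered here in time [2 * h]. *)
set (l t := (coord ax (c (tau + h)) + mx * (t - (tau + h)),
             coord ay (c (tau + h)) + my * (t - (tau + h)),
             coord az (c (tau + h)))).
destruct (speed_reverse alpha 0 c r (delta + tau) _ _ (fun t => eq_refl) Hc)
  as [Cr Sr].
destruct (horizontal_line alpha (c (tau + h)) mx my (tau + h)) as [Cl Sl].
fold l in Cl, Sl.
assert (Ez : forall t, 0 < t < T - s -> coord az (c (t + s)) = coord az (c t))
  by (intros; apply Hper; assumption).
assert (Eh : tau + h = delta + h + s) by (unfold tau; ring).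
assert (Ecr : c delta = r delta).
{ unfold r; replace (delta + tau - delta) with tau by ring.
  apply triple_eq; intros []; simpl; [ring | ring | ].
  symmetry; apply Ez; lra. }
assert (Erl : r (tau - h) = l (tau - h)).
{ unfold r, l; replace (delta + tau - (tau - h)) with (delta + h) by ring.
  (* The displacement over one period does not depend on the starting time, because the velocity is
     periodic. *)
  assert (K : forall k, coord k (c (tau + h)) - coord k (c (delta + h))
                        = coord k (c tau) - coord k (c delta)).
  { intros k; rewrite Eh.
    apply (derive_0_const (fun x => coord k (c (x + s)) - coord k (c x)));
      [lra | intros x Hx].
    replace 0 with (scal 1 (velocity c k (x + s)) - velocity c k x)
      by (rewrite (proj2 (Hper x ltac:(lra)));
          unfold scal; simpl; unfold mult; simpl; ring).
    apply @is_derive_minus; [ | apply Dc].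
    apply (is_derive_comp (fun y => coord k (c y)) (fun y => y + s));
      [apply Dc | auto_derive; auto]. }
  replace (tau - h - (tau + h)) with (- 2 * h) by ring.
  apply triple_eq; intros []; simpl.
  - replace (mx * (- 2 * h))
      with (- 2 * (coord ax (c (delta + h)) - coord ax (c delta)))
      by (unfold mx; field; lra).
    generalize (K ax); lra.
  - replace (my * (- 2 * h))
      with (- 2 * (coord ay (c (delta + h)) - coord ay (c delta)))
      by (unfold my; field; lra).
    generalize (K ay); lra.
  - rewrite Eh; symmetry; apply Ez; lra. }
assert (Elc : l (tau + h) = c (tau + h)).
{ unfold l; replace (tau + h - (tau + h)) with 0 by ring.
  apply triple_eq; intros []; simpl; ring. }
assert (P1 : path alpha 0 delta c ((delta - 0) * 1)).
{ apply path_single; [assumption | assumption | ].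
  apply is_RInt_eq_const; [lra | intros; apply Hsp; lra]. }
assert (tau0 : delta + s = tau) by reflexivity.
(* [c] on [[0, delta]], the rotated and reversed period [r], the chord [l], and
   [c] on [[tau + h, T]]. *)
assert (P2 := path_glue _ _ _ (tau - h) _ ((tau - h - delta) * 1) c r P1
  ltac:(lra) Cr Ecr).
assert (P3 := path_glue _ _ _ (tau + h) _ ((tau + h - (tau - h)) * kappa) _ l
  (P2 ltac:(apply is_RInt_eq_const; [lra | intros; rewrite Sr; apply Hsp; lra]))
  ltac:(lra) Cl).
clear P2.
assert (P4 := path_glue _ _ _ T _ ((T - (tau + h)) * 1) _ c
  (P3 ltac:(rewrite glue_r; [exact Erl | exact Ecr | lra])
      ltac:(apply is_RInt_eq_const; [lra | intros; rewrite Sl;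
            unfold kappa; rewrite Eh, Ez by lra; reflexivity]))
  ltac:(lra) Hc).
clear P3.
assert (P5 := P4
  ltac:(rewrite glue_r; [exact Elc | rewrite glue_r; [exact Erl | exact Ecr | lra]
                        | lra])
  ltac:(apply is_RInt_eq_const; [lra | intros; apply Hsp; lra])).
clear P4.
apply riem_dist_le in P5.
rewrite 3!(glue_l _ _ _ 0) in P5 by lra.
rewrite glue_r in P5; [ | | lra].
2: { rewrite glue_r; [exact Elc | rewrite glue_r; [exact Erl | exact Ecr | lra]
                     | lra]. }
apply Rbar_le_lt_trans with (1 := P5).
change ((delta - 0) * 1 + (tau - h - delta) * 1 + (tau + h - (tau - h)) * kappa
        + (T - (tau + h)) * 1 < T).
nra.
Qed.

(* If [z] vanished on an interval, [Sigma] would vanish along the curve there, and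
   the curve would be constant. *)
Lemma vertical_velocity_nonzero (alpha b : R) (u : R -> triple) :
  0 < b -> integral_curve alpha u -> Sigma alpha (u 0) <> (0, 0, 0) ->
  exists t, 0 < t < b /\ coord az (u t) <> 0.
Proof.
intros Hb Hu H0.
apply NNPP; intros N.
assert (Z : forall t, 0 < t < b -> coord az (u t) = 0)
  by (intros t Ht; apply NNPP; intros Hz; apply N; exists t; split; assumption).
assert (S : forall t, 0 < t < b -> Sigma alpha (u t) = (0, 0, 0)).
{ intros t Ht.
  assert (Hz : is_derive (fun s => coord az (u s)) t 0).
  { apply is_derive_ext_loc with (fun _ => 0); [ | apply @is_derive_const].
    apply filter_imp with (2 := locally_between _ _ _ Ht).
    intros s Hs; symmetry; apply Z, Hs. }
  apply triple_eq; intros k; destruct k.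
  - rewrite coord_Sigma, (Z t Ht); simpl; ring.
  - rewrite coord_Sigma, (Z t Ht); simpl; ring.
  - rewrite <- (is_derive_unique _ _ _ (Hu t az)).
    apply is_derive_unique, Hz. }
apply H0; rewrite <- (S (b / 2)) by lra; f_equal.
apply triple_eq; intros k.
(* The derivative is known to vanish only inside the interval; continuity carries the constancy to
   time [0]. *)
destruct (MVT_gen (fun s => coord k (u s)) 0 (b / 2) (fun _ => 0))
  as (x & _ & E); rewrite ?Rmin_left, ?Rmax_right in * by lra; [ | | lra].
- intros x Hx.
  replace 0 with (coord k (Sigma alpha (u x))); [apply Hu | ].
  rewrite S by lra; destruct k; reflexivity.
- intros x _; apply derivable_continuous_pt.
  eexists; apply is_derive_Reals, Hu.
Qed.

(** Uniqueness identifies [frame_velocity] with [u], so it has period [s]; [s] may be any return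
    time below [T], the first or a later one. *)
Lemma loop_not_minimizing (alpha T s : R) (v : triple) (c u : R -> triple) :
  0 < alpha <= 1 -> geodesic_segment alpha T v c ->
  Sigma alpha v <> (0, 0, 0) -> coord ax v <> 0 ->
  integral_curve alpha u -> u 0 = v -> u s = v -> 0 < s < T ->
  Rbar_lt (riem_dist alpha (c 0) (c T)) (Finite T).
Proof.
intros Ha Hc Hv Hvx Hu u0 us Hs.
assert (HS : unit_sphere v) by apply Hc.
assert (V0 := frame_velocity_0 alpha T v c Hc).
assert (VI := frame_velocity_integral alpha T v c Hc).
assert (W : forall t, 0 <= t <= T -> frame_velocity alpha c t = u t).
{ intros t Ht; apply (integral_curve_unique alpha T); auto.
  - apply integral_curve_sub, Hu.
  - rewrite V0; assumption.
  - rewrite V0; auto. }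
assert (U : forall t, 0 <= t -> u (t + s) = u t).
{ intros t Ht.
  apply (integral_curve_unique alpha t t (fun t => u (t + s))); auto.
  - apply integral_curve_sub, integral_curve_shift, Hu.
  - apply integral_curve_sub, Hu.
  - rewrite Rplus_0_l, us; assumption.
  - rewrite Rplus_0_l, us; auto.
  - lra. }
assert (Wper : forall t, 0 <= t <= T - s ->
  frame_velocity alpha c (t + s) = frame_velocity alpha c t)
  by (intros t Ht; rewrite !W, U by lra; reflexivity).
(* This is the momentum [exp (- 2 z) x'] of translations in [x]. Being nonzero, it determines [z]
   from the frame velocity, so [z] inherits the period. *)
assert (M : forall t, 0 <= t <= T ->
  exp (- 1 * coord az (c t)) * coord ax (frame_velocity alpha c t)
  = exp (- 1 * coord az (c 0)) * coord ax v).
{ intros t Ht; rewrite <- V0.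
  apply (derive_0_const (fun r =>
    exp (- 1 * coord az (c r)) * coord ax (frame_velocity alpha c r)));
    [lra | intros r Hr].
  assert (D := is_derive_frame (- 1) _ (fun x => coord az (c x)) r _ _
    (VI r ax ltac:(lra)) (geodesic_derive alpha T v c r az Hc ltac:(lra))).
  rewrite coord_Sigma in D.
  match type of D with is_derive _ _ ?d => replace 0 with d; [exact D | ] end.
  simpl; ring. }
assert (Zper : forall t, 0 <= t <= T - s -> coord az (c (t + s)) = coord az (c t)).
{ intros t Ht.
  assert (E := M t ltac:(lra)); assert (E' := M (t + s) ltac:(lra)).
  rewrite (Wper t Ht) in E'.
  assert (P := exp_pos (- 1 * coord az (c 0))).
  assert (N : coord ax (frame_velocity alpha c t) <> 0).
  { intros N; rewrite N, Rmult_0_r in E.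
    destruct (Rmult_integral _ _ (eq_sym E)); [lra | contradiction]. }
  rewrite <- E in E'; apply Rmult_eq_reg_r in E'; [ | assumption].
  apply exp_inv in E'; lra. }
assert (Vper : forall t k, 0 <= t <= T - s ->
  velocity c k (t + s) = velocity c k t).
{ intros t k Ht; assert (E := Wper t Ht); unfold frame_velocity in E.
  rewrite (Zper t Ht) in E; injection E as Ex Ey Ez.
  destruct k; [ | | assumption].
  - apply Rmult_eq_reg_l in Ex; [assumption | apply Rgt_not_eq, exp_pos].
  - apply Rmult_eq_reg_l in Ey; [assumption | apply Rgt_not_eq, exp_pos]. }
destruct (vertical_velocity_nonzero alpha (T - s) u) as (delta & Hd & Hz);
  [lra | assumption | rewrite u0; assumption | ].
rewrite <- W in Hz by lra.
(* [periodic_shortcut] asks for a curve that is [C^1] on the whole line, so [c] is replaced by an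
   extension agreeing with it on [[0, T]]. *)
destruct (geodesic_C1_extension alpha T v c Hc) as (d & Cd & Ed).
assert (Vd : forall t k, 0 < t < T -> velocity d k t = velocity c k t).
{ intros t k Ht; apply (velocity_ext 0 T); [ | assumption].
  intros x Hx; apply Ed; lra. }
rewrite <- !Ed by lra.
apply (periodic_shortcut alpha T delta s); try lra; auto.
- intros t Ht; rewrite <- (geodesic_unit_speed alpha T v c t Hc) by lra.
  apply (speed_ext alpha 0 T); [ | assumption].
  intros x Hx; apply Ed; lra.
- intros t Ht; split; [rewrite !Ed by lra; apply Zper; lra | ].
  intros k; rewrite !Vd by lra; apply Vper; lra.
- rewrite Vd by lra; exact Hz.
Qed.

(** * From the period to the two cases *)

(** The infimum need not be known to be attained: without a return time below [T], [T] would be a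
    lower bound of the return times. *)
Lemma period_lt_cases (alpha T : R) (v : triple) :
  Rbar_lt (period alpha v) (Finite T) ->
  coord ax v * coord ay v <> 0 /\
  ((Sigma alpha v = (0, 0, 0) /\ PI * sqrt 2 / sqrt alpha < T) \/
   (Sigma alpha v <> (0, 0, 0) /\
    exists s u, 0 < s < T /\ integral_curve alpha u /\ u 0 = v /\ u s = v)).
Proof.
unfold period; destruct (Req_EM_T _ 0) as [_ | Hxy]; [intros [] | ].
intros H; split; [assumption | ].
destruct (excluded_middle_informative _) as [Hv | Hv];
  [left; split; assumption | right; split; [assumption | ]].
apply NNPP; intros N.
apply (Rbar_lt_not_le _ _ H).
apply (proj2 (Glb_Rbar_correct _)); intros s (Hs & u & Hu).
apply Rnot_lt_le; intros HsT; apply N; exists s, u; auto.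
Qed.

Theorem corollary3p12 (alpha T : R) (v : triple) (c : R -> triple)
  (halpha : 0 < alpha <= 1) (hlarge : large_segment alpha T v c) :
  Rbar_lt (riem_dist alpha (c 0) (c T)) (Finite (curve_length alpha c 0 T)).
Proof.
destruct hlarge as [Hc HP].
rewrite (geodesic_length alpha T v c Hc).
destruct (period_lt_cases alpha T v HP)
  as [Hxy [[Hv HT] | [Hv (s & u & Hs & Hu & u0 & us)]]].
- apply (equilibrium_not_minimizing alpha T v); assumption.
- apply (loop_not_minimizing alpha T s v c u); try assumption.
  intros Hx; apply Hxy; rewrite Hx; ring.
Qed.
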